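(* For each $1<p\le\infty$, $(\mathfrak T_p,\mathfrak t_p)$ is a Banach ideal. That is: $\mathfrak T_p$ is an operator ideal, $\mathfrak t_p$ is an ideal norm on it, and for all Banach spaces $X,Y$, $(\mathfrak T_p(X,Y),\mathfrak t_p)$ is a Banach space.
   Context: All Banach spaces are over $\mathbb K\in\{\mathbb R,\mathbb C\}$. For an operator $A:X\to Y$ and $1<p<\infty$, $T_p(A)$ is the infimum of $C$ such that $A$ satisfies $C$-$\ell_p$ upper tree estimates, and $T_\infty(A)$ the infimum of $C$ such that $A$ satisfies $C$-$c_0$ upper tree estimates ($\infty$ if no such $C$). $\mathfrak t_p(A)=\|A\|+T_p(A)$ and $\mathfrak T_p$ is the class of operators with $\mathfrak t_p(A)<\infty$; $\mathfrak T_p(X,Y)$ denotes those from $X$ to $Y$. (By Theorem 1.1, $\mathfrak T_p$ is the class of $p$-asymptotically uniformly smoothable operators for $p<\infty$ and of asymptotically uniformly flattenable operators for $p=\infty$.) Upper tree estimates: $D$ is a weak neighborhood basis of $0$ in $X$ directed by reverse inclusion; $D_0\subset D$ is cofinal if each $u\in D$ has some $v\in D_0$ with $v\subset u$, eventual if $D\setminus D_0$ is not cofinal; $D^{<\mathbb N}=\bigcup_nD^n$, $t|_m$ initial segment. $B\subset D^{<\mathbb N}$ is inevitable if $\{u:(u)\in B\}$ is eventual and for each $(u_i)_{i=1}^n\in B$, $\{u:(u_1,\dots,u_n,u)\in B\}$ is eventual; big if it contains an inevitable subset. $(x_t)$ is normally weakly null if $x_t\in u_n$ for $t=(u_i)_{i=1}^n$.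 $A$ satisfies $C$-$\ell_p$ (resp. $C$-$c_0$) upper tree estimates if for every normally weakly null $(x_t)\subset B_X$ the set $\bigcup_n\{t\in D^n:\|A\sum_{i=1}^na_ix_{t|_i}\|\le C\|(a_i)\|_{\ell_p^n}\ (\text{resp. }\le C\max_i|a_i|)\ \forall(a_i)\in\mathbb K^n\}$ is big. An operator ideal is a class $\mathfrak I$ of operators such that $ABC\in\mathfrak I$ whenever $B\in\mathfrak I$ and $A,C$ are bounded operators composable with it, $I_{\mathbb K}\in\mathfrak I$, and each $\mathfrak I(X,Y)$ is a linear subspace. An ideal norm $\iota$ on $\mathfrak I$ is a norm on each $\mathfrak I(X,Y)$ with $\iota(ABC)\le\|A\|\iota(B)\|C\|$ and $\iota(x^*\otimes y)=\|x^*\|\|y\|$ for rank-one operators $x\mapsto x^*(x)y$. *)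

(* Defs.v *)
From mathcomp Require Import all_boot all_order all_algebra.
From mathcomp Require Import complex.
From mathcomp Require Import all_classical all_reals all_analysis.
Set Implicit Arguments. Unset Strict Implicit. Unset Printing Implicit Defensive.
Import Order.TTheory GRing.Theory Num.Theory.
Import numFieldNormedType.Exports.
Local Open Scope classical_set_scope.
Local Open Scope ring_scope.

(* Scalars: K is a numFieldType (instantiated with R or R[i] for R : realType);
   md : K -> R is the modulus of a scalar, as a real number
   (|.| for K = R, Re |.| for K = R[i]).  All norms are read through md, so
   that all norm values, constants C, etc. live in the real field R. *)
Section UpperTree.
Variables (R : realType) (K : numFieldType) (md : K -> R).

Definition lin (X Y : normedModType K) (A : X -> Y) : Prop :=
  forall (a : K) (x y : X), A (a *: x + y) = a *: A x + A y.

Definition opnorm (X Y : normedModType K) (A : X -> Y) : \bar R :=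
  ereal_sup [set (md `|A x|)%:E | x in [set x : X | md `|x| <= 1]].

Definition bounded_op (X Y : normedModType K) (A : X -> Y) : Prop :=
  lin A /\ (opnorm A < +oo)%E.

Section Weak.
Variable X : normedModType K.

Definition weak_open (U : set X) : Prop :=
  forall x, U x -> exists (n : nat) (f : 'I_n -> X -> K^o),
    (forall i, lin (f i) /\ continuous (f i)) /\
    exists eps : R, 0 < eps /\
      [set y | forall i, md `|f i (y - x)| < eps] `<=` U.

Definition wnbhd0 := {U : set X | weak_open U /\ U 0}.

Definition cofinal (D0 : set wnbhd0) : Prop :=
  forall u : wnbhd0, exists v : wnbhd0, D0 v /\ (sval v `<=` sval u).

Definition eventual (D0 : set wnbhd0) : Prop := ~ cofinal (~` D0).

Definition inevitable (B : set (seq wnbhd0)) : Prop :=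
  eventual [set u | B [:: u]] /\
  forall t, B t -> eventual [set u | B (rcons t u)].

Definition big (B : set (seq wnbhd0)) : Prop :=
  exists B', B' `<=` B /\ inevitable B'.

(* normally weakly null trees in B_X, indexed by nonempty t in D^{<N}
   (the value at the empty sequence is irrelevant) *)
Definition nwn_tree (x : seq wnbhd0 -> X) : Prop :=
  forall t u, sval u (x (rcons t u)) /\ md `|x (rcons t u)| <= 1.

End Weak.

(* ||(a_i)||_{l_p^n} for p = q%:E (1<q<oo), and max_i |a_i| for p = +oo;
   applied to the moduli a_i >= 0 *)
Definition lpnorm (p : \bar R) (n : nat) (a : 'I_n -> R) : R :=
  match p with
  | EFin q => (\sum_(i < n) (a i) `^ q) `^ q^-1
  | _ => \big[Order.max/0]_(i < n) a i
  end.

Definition upper_tree_est (X Y : normedModType K) (p : \bar R) (A : X -> Y)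
    (C : R) : Prop :=
  forall x : seq (wnbhd0 X) -> X, nwn_tree x ->
    big [set t | forall a : 'I_(size t) -> K,
           md `|A (\sum_(i < size t) a i *: x (take i.+1 t))|
             <= C * lpnorm p (fun i => md (a i))].

Definition Tp (X Y : normedModType K) (p : \bar R) (A : X -> Y) : \bar R :=
  ereal_inf [set C%:E | C in [set C | upper_tree_est p A C]].

Definition tp (X Y : normedModType K) (p : \bar R) (A : X -> Y) : \bar R :=
  (opnorm A + Tp p A)%E.

Definition Tclass (X Y : normedModType K) (p : \bar R) (A : X -> Y) : Prop :=
  lin A /\ (tp p A < +oo)%E.

Definition Banach_ideal (p : \bar R) : Prop :=
  (forall (W X Y Z : completeNormedModType K)
          (A : Y -> Z) (B : X -> Y) (C : W -> X),
      bounded_op A -> Tclass p B -> bounded_op C -> Tclass p (A \o B \o C))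
  /\ Tclass p (fun x : K^o => x)
  /\ (forall X Y : completeNormedModType K,
        Tclass p (fun _ : X => 0 : Y)
        /\ (forall A B : X -> Y, Tclass p A -> Tclass p B ->
              Tclass p (fun x => A x + B x))
        /\ (forall (c : K) (A : X -> Y), Tclass p A ->
              Tclass p (fun x => c *: A x)))
  /\ (forall X Y : completeNormedModType K,
        (forall A : X -> Y, Tclass p A -> (0 <= tp p A)%E)
        /\ (forall A : X -> Y, Tclass p A -> tp p A = 0%E -> A = (fun _ => 0))
        /\ (forall (c : K) (A : X -> Y), Tclass p A ->
              tp p (fun x => (c *: A x)%R) = ((md c)%:E * tp p A)%E)
        /\ (forall A B : X -> Y, Tclass p A -> Tclass p B ->
              (tp p (fun x => (A x + B x)%R) <= tp p A + tp p B)%E))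
  /\ (forall (W X Y Z : completeNormedModType K)
          (A : Y -> Z) (B : X -> Y) (C : W -> X),
      bounded_op A -> Tclass p B -> bounded_op C ->
      (tp p (A \o B \o C) <= opnorm A * tp p B * opnorm C)%E)
  /\ (forall (X Y : completeNormedModType K) (f : X -> K^o) (y : Y),
        bounded_op f ->
        tp p (fun x => f x *: y) = (opnorm f * (md `|y|)%:E)%E)
  /\ (forall (X Y : completeNormedModType K) (A : nat -> X -> Y),
        (forall n, Tclass p (A n)) ->
        (forall e : R, 0 < e -> exists N : nat, forall m n : nat,
            (N <= m)%N -> (N <= n)%N ->
            (tp p (fun x => (A m x - A n x)%R) < e%:E)%E) ->
        exists L : X -> Y, Tclass p L /\
          forall e : R, 0 < e -> exists N : nat, forall n : nat,
            (N <= n)%N -> (tp p (fun x => (A n x - L x)%R) < e%:E)%E).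

End UpperTree.

(* Main.v *)
Require Import Defs.
From mathcomp Require Import all_boot all_order all_algebra.
From mathcomp Require Import complex.
From mathcomp Require Import all_classical all_reals all_analysis.
From mathcomp Require Import ring lra.

(* Sums and left compositions are immediate since finitely many big sets have a
   big intersection.  For right composition with C : W -> X, suppose the tree
   estimate of B C fails along a tree over W.  The game in which one player
   picks neighborhoods and the other picks nodes inside them, trying to reach a
   bad branch, is open for the latter, who thus has a winning strategy; playing
   it against the preimages C^-1(v) gives a tree over X violating the estimate
   of B.  For completeness, write A_n - L as a series of differences D_k along a
   fast subsequence.  Only finitely many tree estimates can be imposed at a
   node, so D_k is estimated by its operator norm on the first k nodes and by its
   tree constant afterwards, which costs a factor k + 1. *)

Set Implicit Arguments. Unset Strict Implicit. Unset Printing Implicit Defensive.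
Import Order.TTheory GRing.Theory Num.Theory.
Import numFieldNormedType.Exports.
Local Open Scope ring_scope.

(** * Eventual and big sets; escape strategies *)

Section BigSets.
Local Open Scope classical_set_scope.
Context {R : realType} {K : numFieldType} {md : K -> R}.
Context {X : normedModType K}.
Local Notation D := (wnbhd0 md X).

(** Negating cofinality of the complement yields one neighborhood below which nothing lies outside
    [D0]. *)
Lemma eventualP (D0 : set D) :
  eventual D0 <-> exists u : D, forall v : D, sval v `<=` sval u -> D0 v.
Proof.
split=> [ev|[u uD0] cof].
- apply: contrapT => nex; apply: ev => u; apply: contrapT => nu.
  apply: nex; exists u => v vu; apply: contrapT => nv.
  by apply: nu; exists v.
- by have [v [nv vu]] := cof u; apply: nv; exact: uD0.
Qed.

Lemma weak_openT : weak_open md (setT : set X).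
Proof.
move=> x _; exists 0%N, (fun _ _ => 0); split; first by case.
by exists 1; split.
Qed.

Definition wnbhd0T : D := exist _ setT (conj weak_openT I).

Lemma weak_openI (U V : set X) :
  weak_open md U -> weak_open md V -> weak_open md (U `&` V).
Proof.
move=> oU oV x [Ux Vx].
have [m [f [fP [e [e0 eU]]]]] := oU _ Ux.
have [n [g [gP [d [d0 dV]]]]] := oV _ Vx.
exists (m + n)%N, (fun i => match fintype.split i with inl j => f j | inr j => g j end).
split; first by move=> i; case: (fintype.split i) => j; [exact: fP|exact: gP].
exists (Num.min e d); split; first by rewrite lt_min e0 d0.
move=> y yP; split.
- apply: eU => j; have := yP (unsplit (inl j)).
  by rewrite unsplitK lt_min => /andP[].
- apply: dV => j; have := yP (unsplit (inr j)).
  by rewrite unsplitK lt_min => /andP[].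
Qed.

Definition wnbhd0I (u v : D) : D :=
  exist _ (sval u `&` sval v)
    (conj (weak_openI (svalP u).1 (svalP v).1)
          (conj (svalP u).2 (svalP v).2)).

Lemma eventualT : eventual (setT : set D).
Proof. by apply/eventualP; exists wnbhd0T. Qed.

Lemma eventualS (D0 D1 : set D) : D0 `<=` D1 -> eventual D0 -> eventual D1.
Proof.
move=> D01 /eventualP[u uD]; apply/eventualP; exists u => v vu.
by apply: D01; exact: uD.
Qed.

Lemma eventualI (D0 D1 : set D) :
  eventual D0 -> eventual D1 -> eventual (D0 `&` D1).
Proof.
move=> /eventualP[u uD] /eventualP[v vD]; apply/eventualP.
exists (wnbhd0I u v) => w wuv; split; [apply: uD|apply: vD].
- by move=> x /wuv[].
- by move=> x /wuv[].
Qed.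

Lemma eventual_forall_ltn (n : nat) (D_ : nat -> set D) :
  (forall k, (k < n)%N -> eventual (D_ k)) ->
  eventual [set u | forall k, (k < n)%N -> D_ k u].
Proof.
elim: n => [|n IHn] ev; first by apply: eventualS eventualT.
have : eventual ([set u | forall k, (k < n)%N -> D_ k u] `&` D_ n).
  by apply: eventualI; [apply: IHn => k kn; apply: ev; exact: ltnW|exact: ev].
apply: eventualS => u [un uDn] k; rewrite ltnS leq_eqVlt => /predU1P[->//|].
exact: un.
Qed.

Lemma eventual_nonempty (D0 : set D) : eventual D0 -> D0 !=set0.
Proof. by move=> /eventualP[u uD]; exists u; exact: uD. Qed.

(** [B] is its own inevitable witness. Admitting the empty sequence merges the root clause of
    inevitability with the extension clause. *)
Lemma big_rec (B : set (seq D)) :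
  B [::] -> (forall t, B t -> eventual [set u | B (rcons t u)]) -> big B.
Proof. by move=> B0 BS; exists B; split=> //; split=> //; exact: (BS [::]). Qed.

Lemma bigS (B B1 : set (seq D)) : B `<=` B1 -> big B -> big B1.
Proof. by move=> BB1 [I0 [IB II]]; exists I0; split=> //; apply: subset_trans BB1. Qed.

Lemma bigI (B B1 : set (seq D)) : big B -> big B1 -> big (B `&` B1).
Proof.
move=> [I0 [IB [I00 I0S]]] [I1 [IB1 [I10 I1S]]]; exists (I0 `&` I1).
split; first by move=> t [/IB ? /IB1 ?].
split; first exact: eventualI.
by move=> t [/I0S ? /I1S ?]; exact: eventualI.
Qed.

Lemma big_nonempty (B : set (seq D)) : big B -> exists u, B [:: u].
Proof. by move=> [I0 [IB [/eventual_nonempty[u /IB Bu] _]]]; exists u. Qed.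

(* At each node only finitely many of the sets [G s] have been started, which
   is why countably many conditions can be met simultaneously. *)
Lemma big_delayed (G : seq D -> set (seq D)) : (forall s, big (G s)) ->
  big [set t | forall k, (k < size t)%N -> G (take k t) (drop k t)].
Proof.
move=> /choice[J JP].
apply: (@bigS [set t | forall k, (k < size t)%N -> J (take k t) (drop k t)]).
  by move=> t Jt k kt; apply: (JP _).1; exact: Jt.
apply: big_rec => // t Jt.
(* Extending [t] continues the sets started at [k < size t] and starts a new one at [k = size t]. *)
have : eventual [set u | forall k, (k < (size t).+1)%N ->
    J (take k t) (rcons (drop k t) u)].
  apply: eventual_forall_ltn => k; rewrite ltnS leq_eqVlt => /predU1P[->|kt].
    by rewrite drop_size; exact: (JP _).2.1.
  by apply: (JP _).2.2; exact: Jt.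
apply: eventualS => u Ju k; rewrite size_rcons => kt.
have := Ju k kt; move: kt; rewrite ltnS => kt.
rewrite -(cats1 t u) takel_cat// drop_cat cats1.
by case: ltngtP kt => // -> _; rewrite drop_size subnn.
Qed.

(** After a move inside the inevitable witness, its section is a witness for the subtree; this lets
    bigness be followed along a play. *)
Lemma big_cons (B : set (seq D)) : big B ->
  exists u, B [:: u] /\ big [set t | B (u :: t)].
Proof.
move=> [J [JB [/eventual_nonempty[u Ju] JS]]]; exists u; split; first exact: JB.
apply: (@bigS [set t | J (u :: t)]) => [t /JB//|].
by apply: big_rec => // t /JS.
Qed.

(* A strategy, from the position [t], for leaving [B] in finitely many moves
   against any choice of neighborhoods. *)
Inductive escape (B : set (seq D)) (t : seq D) : Type :=
  Escape (f : D -> D) of (forall u, sval (f u) `<=` sval u) &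
    (forall u, B (rcons t (f u)) -> escape B (rcons t (f u))).

(* Closed games are determined: when no escape strategy exists, the player
   choosing the neighborhoods only has to avoid the positions which have one. *)
Lemma not_big_escape (B : set (seq D)) : ~ big B -> exists e : escape B [::], True.
Proof.
move=> nB; apply: contrapT => nesc; apply: nB.
(* [escape B t] is data, so that plays can be computed from it; [exists e, True] truncates it to a
   proposition. *)
pose safe t := ~ exists e : escape B t, True.
have ev t : safe t -> eventual [set u | B (rcons t u) /\ safe (rcons t u)].
  move=> nt; apply/eventualP; apply: contrapT => nex; apply: nt.
  have /choice[f fP] : forall u : D, exists v : D, sval v `<=` sval u /\
      (B (rcons t v) -> exists e : escape B (rcons t v), True).
    move=> u; apply: contrapT => nv; apply: nex; exists u => v vu.
    split; first by apply: contrapT => nB; apply: nv; exists v.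
    by move=> esc; apply: nv; exists v.
  unshelve eexists; last by [].
  apply: (@Escape B t f) => u; first exact: (fP u).1.
  by move=> Bu; exact: sval (cid ((fP u).2 Bu)).
exists [set t | B t /\ safe t]; split; first by move=> t [].
by split=> [|t [_ /ev//]]; exact: (ev [::]).
Qed.

End BigSets.

(** * Transporting a failure of bigness along a map of neighborhoods *)

Section Pullback.
Local Open Scope classical_set_scope.
Context {R : realType} {K : numFieldType} {md : K -> R}.
Context {W X : normedModType K}.
Variables (w : wnbhd0 md X -> wnbhd0 md W) (B : set (seq (wnbhd0 md W))).

(** The play of the strategy against the neighborhoods [w v]. Once [B] is left, the moves [w v]
    themselves are appended, so that the length keeps pace with [s]. *)
Fixpoint escape_play t (e : escape B t) (s : seq (wnbhd0 md X)) {struct s} :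
    seq (wnbhd0 md W) :=
  if s is v :: s' then
    let: Escape f _ next := e in
    match pselect (B (rcons t (f (w v)))) with
    | left b => escape_play (next (w v) b) s'
    | right _ => rcons t (f (w v)) ++ map w s'
    end
  else t.

Lemma escape_play_rcons t (e : escape B t) s v :
  exists2 d, escape_play e (rcons s v) = rcons (escape_play e s) d &
    sval d `<=` sval (w v).
Proof.
elim: s t e => [|v' s IHs] t [f sub next] /=; case: pselect => [b|nb].
- by exists (f (w v)) => //; case: (next _ b).
- by exists (f (w v)); rewrite ?cats0.
- exact: IHs.
- by exists (w v) => //; rewrite map_rcons rcons_cat.
Qed.

(** By induction on the strategy: bigness would provide a first move whose reply stays in [B], and
    would pass to the subtree where the remaining strategy is played. *)
Lemma escape_play_not_big t (e : escape B t) : ~ big [set s | B (escape_play e s)].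
Proof.
elim: e => {}t f sub next IH /big_cons[v [/=]].
case: pselect => [b _ bigB|nb].
  exact: (IH _ b bigB).
by rewrite cats0 => /nb.
Qed.

(* Neighborhoods in [W] are only tested through the map [w], so a tree over
   the neighborhoods of [X] cannot see all branches over those of [W]; an
   escape strategy selects the branches it has to see. *)
Lemma not_big_pullback : ~ big B -> exists g : seq (wnbhd0 md X) -> seq (wnbhd0 md W),
  [/\ g [::] = [::],
      forall s v, exists2 d, g (rcons s v) = rcons (g s) d & sval d `<=` sval (w v) &
      ~ big [set s | B (g s)]].
Proof.
move=> /not_big_escape[e _]; exists (escape_play e); split.
- by [].
- exact: escape_play_rcons.
- exact: escape_play_not_big.
Qed.

End Pullback.

(** * Norms read through the modulus *)

Section Modulus.
Local Open Scope classical_set_scope.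
Context {R : realType} {K : numFieldType} {md : K -> R}.
(* [emb] is the inclusion of the reals in the scalars: the identity for K = R
   and x |-> x + 0i for K = R[i]. *)
Variable emb : {rmorphism R -> K}.
Hypothesis mdE : forall z, emb (md z) = `|z|.
Hypothesis emb_le : {mono emb : r s / r <= s}.

Local Notation nr x := (md `|x|).

Let emb_lt : {mono emb : r s / r < s} := leW_mono emb_le.

Let emb_inj : injective emb := inc_inj emb_le.

Lemma md_norm a : md `|a| = md a.
Proof. by apply: emb_inj; rewrite !mdE normr_id. Qed.

Lemma md_ge0 a : 0 <= md a.
Proof. by rewrite -emb_le rmorph0 mdE. Qed.

Lemma mdM a b : md (a * b) = md a * md b.
Proof. by apply: emb_inj; rewrite rmorphM !mdE normrM. Qed.

Lemma md1 : md 1 = 1.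
Proof. by apply: emb_inj; rewrite rmorph1 mdE normr1. Qed.

Lemma md0 : md 0 = 0.
Proof. by apply: emb_inj; rewrite rmorph0 mdE normr0. Qed.

Lemma mdV a : md a^-1 = (md a)^-1.
Proof. by apply: emb_inj; rewrite fmorphV !mdE normfV. Qed.

Lemma md_eq0 a : (md a == 0) = (a == 0).
Proof. by rewrite -(inj_eq emb_inj) mdE rmorph0 normr_eq0. Qed.

Lemma md_emb r : 0 <= r -> md (emb r) = r.
Proof. by move=> r0; apply: emb_inj; rewrite mdE ger0_norm// -(rmorph0 emb) emb_le. Qed.

Section Norm.
Context {X : normedModType K}.
Implicit Types x y : X.

Lemma nrE x : emb (nr x) = `|x|.
Proof. by rewrite mdE normr_id. Qed.

Lemma nr0 : nr (0 : X) = 0.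
Proof. by rewrite normr0 md0. Qed.

Lemma nr_eq0 x : (nr x == 0) = (x == 0).
Proof. by rewrite md_eq0 normr_eq0. Qed.

Lemma nrD x y : nr (x + y) <= nr x + nr y.
Proof. by rewrite -emb_le rmorphD !nrE ler_normD. Qed.

Lemma nrZ a x : nr (a *: x) = md a * nr x.
Proof. by rewrite normrZ mdM md_norm. Qed.

Lemma nr_sum (n : nat) (x : 'I_n -> X) : nr (\sum_(i < n) x i) <= \sum_(i < n) nr (x i).
Proof.
elim/big_ind2: _ => [|u r v s ur vs|//]; first by rewrite nr0.
exact: le_trans (nrD _ _) (lerD ur vs).
Qed.

Lemma cvg_nrP (T : Type) (F : set_system T) (FF : Filter F) (f : T -> X) x :
  (forall e, 0 < e -> \forall t \near F, nr (x - f t) < e) -> f @ F --> x.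
Proof.
move=> cvg; apply/cvgrPdist_lt => e e0.
have : 0 < md e by rewrite lt_def md_ge0 md_eq0 gt_eqF.
move=> /cvg; apply: filterS => t; rewrite -emb_lt nrE mdE.
by rewrite (gtr0_norm e0).
Qed.

End Norm.

(** * Linear maps and the operator norm *)

Section Operators.
Context {X Y : normedModType K}.
Implicit Types A : X -> Y.

Lemma lin0 A : lin A -> A 0 = 0.
Proof. by move=> lA; have := lA (-1) 0 0; rewrite scaler0 addr0 scaleN1r addNr. Qed.

Lemma linD A x y : lin A -> A (x + y) = A x + A y.
Proof. by move=> lA; have := lA 1 x y; rewrite !scale1r. Qed.

Lemma linZ A a x : lin A -> A (a *: x) = a *: A x.
Proof. by move=> lA; have := lA a x 0; rewrite !addr0 (lin0 lA) addr0. Qed.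

Lemma linB A x y : lin A -> A (x - y) = A x - A y.
Proof. by move=> lA; rewrite linD// -scaleN1r linZ// scaleN1r. Qed.

Lemma lin_sum A (n : nat) (x : 'I_n -> X) :
  lin A -> A (\sum_(i < n) x i) = \sum_(i < n) A (x i).
Proof.
move=> lA; elim/big_ind2: _ => [|x1 y1 x2 y2 <- <-|//]; first exact: lin0.
exact: linD.
Qed.

Definition op_bound A (c : R) := forall x, nr (A x) <= c * nr x.

Lemma op_bound_opnorm A c : 0 <= c -> op_bound A c -> (opnorm md A <= c%:E)%E.
Proof.
move=> c0 Ac; apply: ge_ereal_sup => _ [x x1 <-]; rewrite lee_fin.
by apply: le_trans (Ac x) _; rewrite ler_piMr.
Qed.

Lemma opnorm_op_bound A c : lin A -> (opnorm md A <= c%:E)%E -> op_bound A c.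
Proof.
move=> lA Ac x; have [->|x0] := eqVneq x 0; first by rewrite lin0// nr0 nr0 mulr0.
have nx0 : 0 < nr x by rewrite lt_def nr_eq0 x0 md_ge0.
have nI : md (emb (nr x)^-1) = (nr x)^-1 by rewrite md_emb// invr_ge0 ltW.
have : ((nr (A (emb (nr x)^-1 *: x)))%:E <= opnorm md A)%E.
  apply: ereal_sup_ubound; exists (emb (nr x)^-1 *: x) => //=.
  by rewrite nrZ nI mulVf// gt_eqF.
move=> /le_trans/(_ Ac).
by rewrite lee_fin linZ// nrZ nI mulrC ler_pdivrMr.
Qed.

Lemma opnorm_ge0 A : (0 <= opnorm md A)%E.
Proof.
apply: (@le_trans _ _ (nr (A 0))%:E); first by rewrite lee_fin md_ge0.
by apply: ereal_sup_ubound; exists 0 => //=; rewrite nr0.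
Qed.

Lemma opnorm_fineK A : (opnorm md A < +oo)%E -> (fine (opnorm md A))%:E = opnorm md A.
Proof. by move=> Aoo; rewrite fineK// ge0_fin_numE// opnorm_ge0. Qed.

Lemma bounded_opP A : bounded_op md A <-> lin A /\ exists2 c, 0 <= c & op_bound A c.
Proof.
split=> -[lA].
- move=> Aoo; split=> //; exists (fine (opnorm md A)).
    by rewrite fine_ge0// opnorm_ge0.
  by apply: opnorm_op_bound => //; rewrite opnorm_fineK.
- move=> [c c0 Ac]; split=> //.
  exact: le_lt_trans (op_bound_opnorm c0 Ac) (ltry _).
Qed.

Lemma bounded_op_continuous A : bounded_op md A -> continuous A.
Proof.
move=> /bounded_opP[lA [c c0 Ac]] x; apply: cvg_nrP => e e0.
(* The [+ 1] keeps the denominator positive when [c = 0]. *)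
have d0 : 0 < e / (c + 1) by rewrite divr_gt0// ltr_wpDl.
have : \forall y \near x, `|x - y| < emb (e / (c + 1)).
  apply: (@cvgr_dist_lt _ _ _ _ _ id x); first exact: cvg_id.
  by rewrite -(rmorph0 emb) emb_lt.
apply: filterS => y; rewrite -nrE emb_lt ltr_pdivlMr ?ltr_wpDl// => xy.
rewrite -linB//; apply: le_lt_trans (Ac _) _; apply: le_lt_trans xy.
by rewrite mulrC ler_wpM2l ?md_ge0// lerDl.
Qed.

End Operators.

(** * Elementary inequalities for [lpnorm] *)

Section LpNorm.
Context {p : \bar R}.
Hypothesis p1 : (1 < p)%E.

Lemma lpnorm_ge0 n (a : 'I_n -> R) : 0 <= lpnorm p a.
Proof. by case: p => [q||] /=; rewrite ?powR_ge0 ?bigmax_ge_id. Qed.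

Lemma le_lpnorm n (a : 'I_n -> R) i : (forall j, 0 <= a j) -> a i <= lpnorm p a.
Proof.
move=> a0; case: p p1 => [q q1||_] /=; rewrite ?le_bigmax//.
have q0 : 0 < q by move: q1; rewrite lte_fin; exact: lt_trans.
rewrite -[leLHS]powRr1// -(@divff _ q) ?gt_eqF// powRrM.
apply: ge0_ler_powR; rewrite ?nnegrE ?invr_ge0 ?powR_ge0 ?(ltW q0)//.
  by rewrite sumr_ge0// => j _; exact: powR_ge0.
rewrite (bigD1 i)//= lerDl sumr_ge0// => j _; exact: powR_ge0.
Qed.

Lemma lpnorm_rshift m n (a : 'I_(m + n) -> R) :
  lpnorm p (fun i => a (rshift m i)) <= lpnorm p a.
Proof.
case: p p1 => [q q1|_|//] /=.
- have q0 : 0 < q by move: q1; rewrite lte_fin; exact: lt_trans.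
  have sum_ge0 k (b : 'I_k -> R) : 0 <= \sum_(i < k) b i `^ q.
    by rewrite sumr_ge0// => i _; exact: powR_ge0.
  apply: ge0_ler_powR; rewrite ?nnegrE ?invr_ge0 ?sum_ge0 ?(ltW q0)//.
  by rewrite big_split_ord /= lerDr sum_ge0.
- apply: bigmax_le => [|i _]; first exact: bigmax_ge_id.
  exact: le_bigmax.
Qed.

End LpNorm.

(** * Tree estimates under sums and compositions *)

Section TreeEstimates.
Variable p : \bar R.
Hypothesis p1 : (1 < p)%E.

(** Coefficients indexed by [nat] instead of ['I_(size t)] avoid casts when [t] is cut or
    concatenated. *)
Definition tree_bound (X Y : normedModType K) (A : X -> Y) (C : R) (T : Type)
    (x : seq T -> X) (t : seq T) := forall a : nat -> K,
  nr (A (\sum_(i < size t) a i *: x (take i.+1 t)))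
    <= C * lpnorm p (fun i : 'I_(size t) => md (a i)).

Lemma upper_tree_estP (X Y : normedModType K) (A : X -> Y) (C : R) :
  upper_tree_est md p A C <->
  forall x : seq (wnbhd0 md X) -> X, nwn_tree x -> big [set t | tree_bound A C x t].
Proof.
split=> est x /est; apply: bigS => t /= bd a; first exact: bd.
have aE i : oapp a 0 (insub (nat_of_ord i)) = a i by rewrite (valK i).
have /= := bd (fun i => oapp a 0 (insub i)).
under eq_bigr do rewrite aE.
by congr (_ <= C * lpnorm p _); apply/funext => i; rewrite aE.
Qed.

Section SameSpaces.
Context {X Y : normedModType K}.
Implicit Types A : X -> Y.

Lemma upper_tree_est_le A C C' : C <= C' ->
  upper_tree_est md p A C -> upper_tree_est md p A C'.
Proof.
move=> CC' est x /est; apply: bigS => t /= bd a; apply: le_trans (bd a) _.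
by rewrite ler_wpM2r// lpnorm_ge0.
Qed.

Lemma nwn_tree0 : nwn_tree (fun _ : seq (wnbhd0 md X) => 0).
Proof. by move=> t u; split; [exact: (svalP u).2|rewrite nr0]. Qed.

(** On the null tree, a branch of length one with coefficient 1 shows that [C] times a positive
    number is nonnegative. *)
Lemma upper_tree_est_ge0 A C : upper_tree_est md p A C -> 0 <= C.
Proof.
move=> /upper_tree_estP/(_ _ nwn_tree0)/big_nonempty[u /(_ (fun=> 1))] /=.
have := @le_lpnorm _ p1 1 (fun=> md 1) ord0 (fun=> md_ge0 1); rewrite md1 => h.
move=> /(le_trans (md_ge0 _)); rewrite pmulr_lge0//.
exact: lt_le_trans h.
Qed.

Lemma upper_tree_est0 : upper_tree_est md p (fun _ : X => 0 : Y) 0.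
Proof.
move=> x _; apply: big_rec => [a /=|t _]; first by rewrite nr0 mul0r.
by apply: eventualS eventualT => u _ a /=; rewrite nr0 mul0r.
Qed.

Lemma upper_tree_estD A B C C' :
  upper_tree_est md p A C -> upper_tree_est md p B C' ->
  upper_tree_est md p (fun x => A x + B x) (C + C').
Proof.
move=> estA estB x xn; have := bigI (estA x xn) (estB x xn).
apply: bigS => t /= [bdA bdB] a; apply: le_trans (nrD _ _) _.
by rewrite mulrDl lerD.
Qed.

End SameSpaces.

Lemma upper_tree_est_compl (X Y Z : normedModType K) (A : Y -> Z) (B : X -> Y) c C :
  0 <= c -> op_bound A c -> upper_tree_est md p B C ->
  upper_tree_est md p (A \o B) (c * C).
Proof.
move=> c0 Ac est x /est; apply: bigS => t /= bd a; apply: le_trans (Ac _) _.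
by rewrite -mulrA ler_wpM2l.
Qed.

Lemma weak_open_preimage (W X : normedModType K) (A : W -> X) (U : set X) :
  bounded_op md A -> weak_open md U -> weak_open md (A @^-1` U).
Proof.
move=> bA oU x /oU[n [f [fP [e [e0 eU]]]]]; have [lA _] := bA.
exists n, (fun i => f i \o A); split.
  move=> i; have [lf cf] := fP i; split.
    by move=> a y z /=; rewrite lA lf.
  move=> y; apply: continuous_comp; first exact: bounded_op_continuous.
  exact: cf.
exists e; split=> // y yP; apply: eU => i /=.
by have := yP i; rewrite /= linB.
Qed.

(** The bound 1 keeps the images under [B] of tree nodes in the unit ball, so that they can form a
    tree over [X]. *)
Lemma upper_tree_est_compr1 (W X Y : normedModType K) (A : X -> Y) (B : W -> X) C :
  lin B -> op_bound B 1 -> upper_tree_est md p A C ->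
  upper_tree_est md p (A \o B) C.
Proof.
move=> lB B1 /upper_tree_estP est; apply/upper_tree_estP => x xn.
have bB : bounded_op md B by apply/bounded_opP; split=> //; exists 1.
apply: contrapT.
have /choice[w wP] : forall v : wnbhd0 md X, exists u : wnbhd0 md W,
    sval u = B @^-1` (sval v).
  move=> v; have B0 : sval v (B 0) by rewrite lin0//; exact: (svalP v).2.
  by exists (exist _ (B @^-1` (sval v))
    (conj (weak_open_preimage bB (svalP v).1) B0)).
move=> /(not_big_pullback w)[g [g0 gS ngood]]; apply: ngood.
have szg s : size (g s) = size s.
  elim/last_ind: s => [|s v IHs]; first by rewrite g0.
  by have [d -> _] := gS s v; rewrite !size_rcons IHs.
(* Initial segments of a play are plays, so the new tree along [s] carries the images of the nodes
   of [x] along the whole branch [g s]. *)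
have takeg s i : take i (g s) = g (take i s).
  elim/last_ind: s => [|s v IHs]; first by rewrite g0.
  have [d gE _] := gS s v; rewrite gE -!cats1 !take_cat szg.
  case: ltnP => // si; case: (i - size s)%N => [|k] /=.
    by rewrite !cats0.
  by rewrite !cats1 gE.
(* The last move [d] lies in the preimage of [v], hence the image of its node lies in [v]. *)
have yn : nwn_tree (fun s => B (x (g s))).
  move=> s v; have [d -> dv] := gS s v; have [xd x1] := xn (g s) d; split.
    by have := dv _ xd; rewrite wP.
  by apply: le_trans (B1 _) _; rewrite mul1r.
apply: bigS (est _ yn) => s /= bd a; rewrite szg /= lin_sum//.
by under eq_bigr do rewrite linZ// takeg; exact: bd.
Qed.

(** Dividing [B] by [c] makes it contractive, and the factor [c] is moved to the left of [A]; for
    [c = 0] the composition vanishes. *)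
Lemma upper_tree_est_compr (W X Y : normedModType K) (A : X -> Y) (B : W -> X) c C :
  lin A -> lin B -> 0 <= c -> op_bound B c -> upper_tree_est md p A C ->
  upper_tree_est md p (A \o B) (c * C).
Proof.
move=> lA lB; rewrite le_eqVlt => /predU1P[<-|c0] Bc est.
  have -> : A \o B = fun=> 0.
    apply/funext => x /=; suff -> : B x = 0 by exact: lin0.
    by apply/eqP; rewrite -nr_eq0 eq_le md_ge0 andbT (le_trans (Bc x))// mul0r.
  by rewrite mul0r; exact: upper_tree_est0.
have e0 : emb c != 0 by rewrite fmorph_eq0 gt_eqF.
have -> : A \o B = ( *:%R (emb c)) \o (A \o (fun x => (emb c)^-1 *: B x)).
  by apply/funext => x /=; rewrite linZ// scalerA divff// scale1r.
apply: upper_tree_est_compl; first exact: ltW.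
  by move=> x; rewrite nrZ md_emb// ltW.
apply: upper_tree_est_compr1 => //.
- by move=> a x y /=; rewrite lB scalerDr !scalerA mulrC.
- by move=> x; rewrite nrZ mul1r mdV (md_emb (ltW c0)) ler_pdivrMl.
Qed.

(** * Tree estimates for series and rank-one operators *)

Section Series.
Context {X Y : normedModType K}.

Lemma nwn_tree_cat (x : seq (wnbhd0 md X) -> X) s :
  nwn_tree x -> nwn_tree (fun t => x (s ++ t)).
Proof. by move=> xn t u; rewrite -rcons_cat; exact: xn. Qed.

Lemma nr_tree_sum (x : seq (wnbhd0 md X) -> X) (t : seq (wnbhd0 md X)) n
    (a : nat -> K) L :
  nwn_tree x -> (n <= size t)%N -> (forall i : 'I_n, md (a i) <= L) ->
  nr (\sum_(i < n) a i *: x (take i.+1 t)) <= n%:R * L.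
Proof.
move=> xn nt aL; apply: le_trans (nr_sum _) _.
rewrite mulr_natl -[in leRHS](card_ord n) -sumr_const.
apply: ler_sum => i _; rewrite nrZ.
have : size (take i.+1 t) = i.+1 by rewrite size_takel// (leq_trans _ nt).
case/lastP: (take i.+1 t) => [//|s v _]; have [_ x1] := xn s v.
by apply: le_trans (aL i); rewrite ler_piMr// md_ge0.
Qed.

(** Splitting the branch after [s], the operator norm costs [d] for each node of [s], and the
    shifted tree estimate costs [d] once more. *)
Lemma tree_bound_delayed (A : X -> Y) d (x : seq (wnbhd0 md X) -> X) s t :
  lin A -> 0 <= d -> op_bound A d -> nwn_tree x ->
  tree_bound A d (fun t => x (s ++ t)) t ->
  tree_bound A ((size s).+1%:R * d) x (s ++ t).
Proof.
move=> lA d0 Ad xn bd a; have := bd (fun i => a (size s + i)%N).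
have aL := @le_lpnorm _ p1 (size (s ++ t)) (fun i => md (a i)) _ (fun i => md_ge0 (a i)).
have := @nr_tree_sum x (s ++ t) (size s) a
  (lpnorm p (fun i : 'I_(size (s ++ t)) => md (a i))) xn.
move: aL; rewrite size_cat => aL /(_ (leq_addr _ _)) /(_ (fun i => aL (lshift _ i))).
set L := lpnorm p _ => hs ht; rewrite big_split_ord /= linD//.
apply: le_trans (nrD _ _) _; rewrite -natr1 !mulrDl mul1r lerD//.
- by apply: le_trans (Ad _) _; rewrite -mulrA mulrCA ler_wpM2l.
- under eq_bigr do rewrite -addnS take_cat ltnNge leq_addr /= addKn.
  apply: le_trans ht _; rewrite ler_wpM2l//.
  exact: (lpnorm_rshift p1 (fun i : 'I_(size s + size t) => md (a i))).
Qed.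

Lemma sum_halves (e : R) n : \sum_(k < n) e / 2 ^+ k.+1 = e - e / 2 ^+ n.
Proof.
elim: n => [|n IHn]; first by rewrite big_ord0 expr0 divr1 subrr.
rewrite big_ord_recr /= IHn exprS; field.
by rewrite expf_neq0// pnatr_eq0.
Qed.

(* [D k] is estimated by its norm on the first [k] nodes of a branch, and by
   its tree estimate only on the rest. *)
Lemma upper_tree_est_series (S : X -> Y) (D Rm : nat -> X -> Y) (d : nat -> R) (e : R) :
  0 <= e ->
  (forall k, lin (D k)) -> (forall k, op_bound (D k) (d k)) ->
  (forall k, upper_tree_est md p (D k) (d k)) ->
  (forall k, op_bound (Rm k) (d k)) ->
  (forall n x, S x = \sum_(k < n) D k x + Rm n x) ->
  (forall k, k.+1%:R * d k <= e / 2 ^+ k.+1) ->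
  upper_tree_est md p S e.
Proof.
move=> e0 lD Dd estD Rd SE de; apply/upper_tree_estP => x xn.
have d0 k : 0 <= d k := upper_tree_est_ge0 (estD k).
apply: bigS (big_delayed (G := fun s => [set t |
    tree_bound (D (size s)) (d (size s)) (fun t => x (s ++ t)) t]) _); last first.
  by move=> s; have /upper_tree_estP := estD (size s); apply; exact: nwn_tree_cat.
move=> t /= tD a; rewrite (SE (size t)).
set v := \sum_(i < size t) a i *: _; set L := lpnorm p _.
have L0 : 0 <= L := lpnorm_ge0 _.
have DvL (k : 'I_(size t)) : nr (D k v) <= e / 2 ^+ k.+1 * L.
  have := tD k (ltn_ord k); have kt : size (take k t) = k by rewrite size_takel// ltnW.
  rewrite kt => /(tree_bound_delayed (lD k) (d0 k) (Dd k) xn) /(_ a).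
  rewrite cat_take_drop kt => /le_trans; apply.
  by rewrite ler_wpM2r.
(* The remainder acts on a sum of [size t] vectors of norm at most [L], so its norm bound
   suffices. *)
have RvL : nr (Rm (size t) v) <= e / 2 ^+ (size t) * L.
  apply: le_trans (Rd _ _) _.
  apply: (@le_trans _ _ (d (size t) * ((size t)%:R * L))).
    rewrite ler_wpM2l// nr_tree_sum// => i.
    exact: (@le_lpnorm _ p1 _ (fun i : 'I_(size t) => md (a i)) i (fun i => md_ge0 (a i))).
  rewrite mulrA ler_wpM2r// mulrC.
  apply: (@le_trans _ _ ((size t).+1%:R * d (size t))).
    by rewrite ler_wpM2r// ler_nat.
  apply: le_trans (de _) _.
  rewrite ler_wpM2l// lef_pV2 ?posrE ?exprn_gt0//.
  by rewrite exprS ler_peMl ?exprn_ge0// ler1n.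
apply: le_trans (nrD _ _) _.
apply: (@le_trans _ _ ((\sum_(k < size t) e / 2 ^+ k.+1) * L + e / 2 ^+ (size t) * L)).
  rewrite lerD// mulr_suml; apply: le_trans (nr_sum _) _.
  exact: ler_sum.
(* The halves and the remainder add up to exactly [e]. *)
by rewrite sum_halves -mulrDl subrK.
Qed.

Lemma weak_open_lt (f : X -> K^o) e :
  bounded_op md f -> weak_open md [set z | nr (f z) < e].
Proof.
move=> bf x /= fx; exists 1%N, (fun=> f); split.
  by move=> _; split; [exact: bf.1|exact: bounded_op_continuous].
exists (e - nr (f x)); split; first by rewrite subr_gt0.
move=> y /(_ ord0); rewrite linB; last exact: bf.1.
rewrite ltrBrDr /=; apply: le_lt_trans.
by rewrite -[in leLHS](subrK (f x) (f y)); exact: nrD.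
Qed.

(* On small enough neighborhoods [f] is summably small along every branch. *)
Lemma upper_tree_est_rank1 (f : X -> K^o) (y : Y) e :
  bounded_op md f -> 0 < e -> upper_tree_est md p (fun x => f x *: y) e.
Proof.
move=> bf e0; have lf := bf.1; apply/upper_tree_estP => x xn.
pose B := [set t : seq (wnbhd0 md X) | forall i, (i < size t)%N ->
  nr (f (x (take i.+1 t))) * nr y <= e / 2 ^+ i.+1].
apply: (@bigS _ _ _ _ B).
  move=> t tB a /=; set L := lpnorm p _.
  rewrite lin_sum// nrZ -md_norm.
  apply: le_trans (ler_wpM2r (md_ge0 _) (nr_sum _)) _.
  rewrite mulr_suml; apply: (@le_trans _ _ (\sum_(i < size t) L * (e / 2 ^+ i.+1))).
    apply: ler_sum => i _; rewrite linZ// nrZ -mulrA ler_pM ?md_ge0//.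
    + by rewrite mulr_ge0 ?md_ge0.
    + exact: (@le_lpnorm _ p1 _ (fun i : 'I_(size t) => md (a i)) i (fun i => md_ge0 (a i))).
    + exact: tB.
  rewrite -mulr_sumr sum_halves mulrC ler_wpM2r ?lpnorm_ge0//.
  by rewrite gerBl divr_ge0 ?exprn_ge0// ltW.
apply: big_rec => // t tB; apply/eventualP.
(* The share of the next node in the budget [e]; the [+ 1] covers [y = 0]. *)
have d0 : 0 < e / 2 ^+ (size t).+1 / (nr y + 1).
  by rewrite !divr_gt0// ?exprn_gt0// ltr_wpDl ?md_ge0.
have f0 : nr (f 0) < e / 2 ^+ (size t).+1 / (nr y + 1) by rewrite lin0// nr0.
pose u0 : wnbhd0 md X := exist _ [set z | nr (f z) < _] (conj (weak_open_lt bf) f0).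
exists u0 => v vu i.
rewrite size_rcons ltnS leq_eqVlt => /predU1P[->|it]; last first.
  by rewrite -cats1 takel_cat//; exact: tB.
rewrite take_oversize ?size_rcons//.
have /= := vu _ (xn t v).1; rewrite ltr_pdivlMr ?ltr_wpDl ?md_ge0// => /ltW.
by apply: le_trans; rewrite ler_wpM2l ?md_ge0// lerDl.
Qed.

End Series.

(** * Norm properties of [tp] *)

Section Norm_tp.
Context {X Y : normedModType K}.
Implicit Types A : X -> Y.

Lemma Tp_ge0 A : (0 <= Tp md p A)%E.
Proof. by apply: le_ereal_inf_tmp => _ [C /upper_tree_est_ge0 C0 <-]; rewrite lee_fin. Qed.

Lemma Tp_lt_est A r : (Tp md p A < r%:E)%E -> upper_tree_est md p A r.
Proof.
move=> /ereal_inf_lt[_ [C estC <-]]; rewrite lte_fin => /ltW Cr.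
exact: upper_tree_est_le estC.
Qed.

(** The slack [e] avoids asking whether the infimum defining [Tp] is attained. *)
Lemma tp_le A a t : 0 <= a -> op_bound A a ->
  (forall e, 0 < e -> upper_tree_est md p A (t + e)) -> (tp md p A <= (a + t)%:E)%E.
Proof.
move=> a0 Aa est; rewrite EFinD leeD ?op_bound_opnorm//.
apply/lee_addgt0Pr => e e0; rewrite -EFinD.
by apply: ereal_inf_lbound; exists (t + e) => //; exact: est.
Qed.

Lemma opnorm_le_tp A : (opnorm md A <= tp md p A)%E.
Proof. by rewrite leeDl// Tp_ge0. Qed.

Lemma tp_ge0 A : (0 <= tp md p A)%E.
Proof. exact: le_trans (opnorm_ge0 A) (opnorm_le_tp A). Qed.

Lemma tp_lt A e : lin A -> (tp md p A < e%:E)%E ->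
  op_bound A e /\ upper_tree_est md p A e.
Proof.
move=> lA Ae; split.
- by apply: opnorm_op_bound => //; exact: le_trans (opnorm_le_tp A) (ltW Ae).
- by apply: Tp_lt_est; apply: le_lt_trans Ae; rewrite leeDr// opnorm_ge0.
Qed.

Lemma tclass_bounds A : Tclass md p A -> exists a t,
  [/\ 0 <= a, op_bound A a, opnorm md A = a%:E, tp md p A = (a + t)%:E &
      forall e, 0 < e -> upper_tree_est md p A (t + e)].
Proof.
move=> [lA Aoo]; have nAoo := le_lt_trans (opnorm_le_tp A) Aoo.
have TAoo : (Tp md p A < +oo)%E.
  by apply: le_lt_trans Aoo; rewrite leeDr// opnorm_ge0.
have nE := opnorm_fineK nAoo; have TE : (fine (Tp md p A))%:E = Tp md p A.
  by rewrite fineK// ge0_fin_numE// Tp_ge0.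
exists (fine (opnorm md A)), (fine (Tp md p A)); split=> //.
- by rewrite fine_ge0// opnorm_ge0.
- by apply: opnorm_op_bound => //; rewrite nE.
- by rewrite EFinD nE TE.
- by move=> e e0; apply: Tp_lt_est; rewrite EFinD TE lteDl ?lte_fin// -TE.
Qed.

Lemma tclass_tp_le A r : lin A -> (tp md p A <= r%:E)%E -> Tclass md p A.
Proof. by move=> lA /le_lt_trans Ar; split=> //; apply: Ar; exact: ltry. Qed.

Lemma tclass_eq0 A : Tclass md p A -> tp md p A = 0%E -> A = fun=> 0.
Proof.
move=> [lA _] A0; apply/funext => x; apply/eqP; rewrite -nr_eq0 eq_le md_ge0 andbT.
have := opnorm_le_tp A; rewrite A0 => A0'.
by have := opnorm_op_bound (c := 0) lA A0' x; rewrite mul0r.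
Qed.

Lemma lin_add A B : lin A -> lin B -> lin (fun x => A x + B x).
Proof. by move=> lA lB a x y /=; rewrite lA lB scalerDr addrACA. Qed.

Lemma lin_scale c A : lin A -> lin (fun x => c *: A x).
Proof. by move=> lA a x y /=; rewrite lA scalerDr !scalerA mulrC. Qed.

Lemma lin_sub A B : lin A -> lin B -> lin (fun x => A x - B x).
Proof. by move=> lA lB a x y /=; rewrite lA lB opprD addrACA -scalerBr. Qed.

Lemma tp_add A B : Tclass md p A -> Tclass md p B ->
  (tp md p (fun x => (A x + B x)%R) <= tp md p A + tp md p B)%E.
Proof.
move=> /tclass_bounds[a [t [a0 Aa _ -> At]]] /tclass_bounds[b [s [b0 Bb _ -> Bs]]].
rewrite -EFinD addrACA; apply: tp_le; first exact: addr_ge0.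
  by move=> x; apply: le_trans (nrD _ _) _; rewrite mulrDl lerD.
move=> e e0; rewrite (splitr e) addrACA; apply: upper_tree_estD.
  by apply: At; rewrite divr_gt0.
by apply: Bs; rewrite divr_gt0.
Qed.

Lemma tclass_add A B : Tclass md p A -> Tclass md p B ->
  Tclass md p (fun x => A x + B x).
Proof.
move=> cA cB; split; first exact: lin_add cA.1 cB.1.
apply: le_lt_trans (tp_add cA cB) _.
by rewrite lte_add_pinfty//; [exact: cA.2|exact: cB.2].
Qed.

Lemma tclass0 : Tclass md p (fun _ : X => 0 : Y).
Proof.
apply: (@tclass_tp_le _ (0 + 0)); first by move=> a x y; rewrite scaler0 addr0.
apply: tp_le => // [x|e e0]; first by rewrite nr0 mul0r.
by apply: upper_tree_est_le (upper_tree_est0); rewrite add0r ltW.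
Qed.

End Norm_tp.

(** * Ideal property, homogeneity, rank-one operators *)

Lemma tp_comp (W X Y Z : normedModType K) (A : Y -> Z) (B : X -> Y) (C : W -> X) :
  bounded_op md A -> Tclass md p B -> bounded_op md C ->
  (tp md p (A \o B \o C) <= opnorm md A * tp md p B * opnorm md C)%E.
Proof.
move=> bA cB bC; have [b [t [b0 Bb _ -> Bt]]] := tclass_bounds cB.
rewrite -(opnorm_fineK bA.2) -(opnorm_fineK bC.2).
set a := fine _; set c := fine _.
have a0 : 0 <= a by rewrite fine_ge0// opnorm_ge0.
have c0 : 0 <= c by rewrite fine_ge0// opnorm_ge0.
have Aa : op_bound A a by apply: opnorm_op_bound (bA.1) _; rewrite opnorm_fineK ?bA.2.
have Cc : op_bound C c by apply: opnorm_op_bound (bC.1) _; rewrite opnorm_fineK ?bC.2.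
rewrite -!EFinM mulrDr mulrDl; apply: tp_le; first by rewrite !mulr_ge0.
  move=> x /=; apply: le_trans (Aa _) _; rewrite -!mulrA ler_wpM2l//.
  by apply: le_trans (Bb _) _; rewrite ler_wpM2l.
(* The slack for [B] is [e / (a * c + 1)], which stays below [e] after multiplication by [a * c]. *)
move=> e e0; have k0 : 0 < a * c + 1 by rewrite ltr_wpDl// mulr_ge0.
apply: (@upper_tree_est_le _ _ _ (c * (a * (t + e / (a * c + 1))))).
  rewrite mulrA [c * a]mulrC mulrDr mulrAC lerD2l mulrA ler_pdivrMr//.
  by rewrite [leLHS]mulrC ler_wpM2l ?lerDl// ltW.
apply: upper_tree_est_compr => //.
- by move=> k x y /=; rewrite cB.1 bA.1.
- exact: bC.1.
- by apply: upper_tree_est_compl => //; apply: Bt; rewrite divr_gt0.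
Qed.

Lemma tclass_comp (W X Y Z : normedModType K) (A : Y -> Z) (B : X -> Y) (C : W -> X) :
  bounded_op md A -> Tclass md p B -> bounded_op md C -> Tclass md p (A \o B \o C).
Proof.
move=> bA cB bC; split; first by move=> a x y /=; rewrite bC.1 cB.1 bA.1.
apply: le_lt_trans (tp_comp bA cB bC) _.
have [b [t [_ _ _ -> _]]] := tclass_bounds cB.
by rewrite -(opnorm_fineK bA.2) -(opnorm_fineK bC.2) -!EFinM ltry.
Qed.

Lemma bounded_op_scale (X : normedModType K) c : bounded_op md (fun x : X => c *: x).
Proof.
apply/bounded_opP; split; first by move=> a x y; rewrite scalerDr !scalerA mulrC.
by exists (md c); [exact: md_ge0|move=> x; rewrite nrZ].
Qed.

Lemma opnorm_scale_le (X : normedModType K) c :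
  (opnorm md (fun x : X => (c *: x)%R) <= (md c)%:E)%E.
Proof. by apply: op_bound_opnorm => [|x]; rewrite ?md_ge0 ?nrZ. Qed.

Lemma tp_scale_le (X Y : normedModType K) c (A : X -> Y) : Tclass md p A ->
  (tp md p (fun x => (c *: A x)%R) <= (md c)%:E * tp md p A)%E.
Proof.
(* Scaling is composition with a homothety on the left and the identity on the right. *)
move=> cA; have [bY bX] := (bounded_op_scale Y c, bounded_op_scale X 1).
have := tp_comp bY cA bX; have -> : ( *:%R c) \o A \o ( *:%R 1) = fun x => c *: A x.
  by apply/funext => x /=; rewrite scale1r.
move=> /le_trans; apply; rewrite -[leRHS]mule1.
apply: lee_pmul; rewrite ?mule_ge0 ?opnorm_ge0 ?tp_ge0//.
  by apply: lee_wpmul2r; rewrite ?tp_ge0// opnorm_scale_le.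
by apply: le_trans (opnorm_scale_le _ _) _; rewrite md1.
Qed.

Lemma tclass_scale (X Y : normedModType K) c (A : X -> Y) : Tclass md p A ->
  Tclass md p (fun x => c *: A x).
Proof.
move=> cA; have := tp_scale_le c cA; have [a [t [_ _ _ -> _]]] := tclass_bounds cA.
by rewrite -EFinM; apply: tclass_tp_le; exact: lin_scale cA.1.
Qed.

Lemma tp_scale (X Y : normedModType K) c (A : X -> Y) : Tclass md p A ->
  (tp md p (fun x => (c *: A x)%R) = (md c)%:E * tp md p A)%E.
Proof.
move=> cA; apply/eqP; rewrite eq_le tp_scale_le//=.
have [->|c0] := eqVneq c 0; first by rewrite md0 mul0e tp_ge0.
have mc0 : 0 < md c by rewrite lt_def md_eq0 c0 md_ge0.
(* The reverse inequality comes from scaling back by [c^-1]. *)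
have := tp_scale_le c^-1 (tclass_scale c cA).
have -> : (fun x => c^-1 *: (c *: A x)) = A.
  by apply/funext => x; rewrite scalerA mulVf// scale1r.
rewrite mdV => /(lee_wpmul2l (x := (md c)%:E)); rewrite lee_fin ltW// => /(_ isT).
by rewrite muleA -EFinM divff ?gt_eqF// mul1e.
Qed.

(** Every positive constant is a tree constant here, so only the operator norm contributes. *)
Lemma tp_rank1 (X Y : normedModType K) (f : X -> K^o) (y : Y) : bounded_op md f ->
  tp md p (fun x => f x *: y) = (opnorm md f * (nr y)%:E)%E.
Proof.
move=> bf; have nrf x : nr (f x *: y) = nr (f x) * nr y by rewrite nrZ -md_norm.
have f0 : 0 <= fine (opnorm md f) by rewrite fine_ge0// opnorm_ge0.
have fP : op_bound f (fine (opnorm md f)).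
  by apply: opnorm_op_bound bf.1 _; rewrite opnorm_fineK ?bf.2.
apply/eqP; rewrite eq_le; apply/andP; split.
  rewrite -(opnorm_fineK bf.2) -EFinM -[in leRHS](addr0 (_ * _)); apply: tp_le.
  - by rewrite mulr_ge0 ?md_ge0.
  - by move=> x; rewrite nrf mulrAC ler_wpM2r ?md_ge0.
  - by move=> e e0; rewrite add0r; exact: upper_tree_est_rank1.
apply: le_trans (opnorm_le_tp _).
have [->|y0] := eqVneq y 0; first by rewrite nr0 mule0 opnorm_ge0.
have ny0 : 0 < nr y by rewrite lt_def nr_eq0 y0 md_ge0.
have bfy : bounded_op md (fun x => f x *: y).
  apply/bounded_opP; split; first by move=> a x z /=; rewrite bf.1 scalerDl scalerA.
  exists (fine (opnorm md f) * nr y); first by rewrite mulr_ge0 ?md_ge0.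
  by move=> x; rewrite nrf mulrAC ler_wpM2r ?md_ge0.
rewrite -(opnorm_fineK bfy.2) -lee_pdivlMr// -EFinM.
apply: op_bound_opnorm; first by rewrite divr_ge0 ?md_ge0// fine_ge0// opnorm_ge0.
move=> x; rewrite mulrAC ler_pdivlMr// -nrf.
by apply: opnorm_op_bound bfy.1 _ _; rewrite opnorm_fineK ?bfy.2.
Qed.

Lemma tclass_id : Tclass md p (fun x : K^o => x).
Proof.
have bid : bounded_op md (fun x : K^o => x).
  by apply/bounded_opP; split=> //; exists 1 => // x; rewrite mul1r.
(* The identity of the scalars is a rank-one operator. *)
have idE : (fun x : K^o => x *: (1 : K^o)) = (fun x => x).
  by apply/funext => x; exact: mulr1.
have := tp_rank1 (1 : K^o) bid; rewrite idE -(opnorm_fineK bid.2) -EFinM => tpE.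
by apply: tclass_tp_le => //; rewrite tpE.
Qed.

(** * Completeness *)

Section Completeness.
Context {X : normedModType K} {Y : completeNormedModType K}.
Variable A : nat -> X -> Y.

Definition op_cauchy := forall e : R, 0 < e -> exists N : nat, forall m n : nat,
  (N <= m)%N -> (N <= n)%N -> op_bound (fun x => A m x - A n x) e.

Lemma op_cauchy_cvg x : op_cauchy -> cvg (A n x @[n --> \oo]).
Proof.
move=> cau; apply/cauchy_cvgP/cauchy_exP => e e0.
have md0' : 0 < md e by rewrite lt_def md_eq0 md_ge0 gt_eqF.
have [|N NP] := cau (md e / (nr x + 1)).
  by rewrite divr_gt0// ltr_wpDl ?md_ge0.
exists (A N x); exists N => // n /= Nn; rewrite -ball_normE /= -nrE.
rewrite -(gtr0_norm e0) -(mdE e) emb_lt; apply: le_lt_trans (NP _ _ (leqnn _) Nn x) _.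
rewrite mulrAC ltr_pdivrMr ?ltr_wpDl ?md_ge0//.
by rewrite ltr_pM2l// ltrDl.
Qed.

Let L x := lim (A n x @[n --> \oo]).

Lemma lin_op_lim : op_cauchy -> (forall n, lin (A n)) -> lin L.
Proof.
move=> cau lA a x y; apply/cvg_lim => //.
rewrite (_ : (fun n => _) = fun n => a *: A n x + A n y); last first.
  by apply/funext => n; rewrite lA.
by apply: cvgD; [apply: cvgZr|]; exact: op_cauchy_cvg.
Qed.

Lemma op_bound_lim N e : op_cauchy ->
  (forall m n, (N <= m)%N -> (N <= n)%N -> op_bound (fun x => A m x - A n x) e) ->
  forall n, (N <= n)%N -> op_bound (fun x => A n x - L x) e.
Proof.
move=> cau NP n Nn x; apply/ler_addgt0Pr => d d0.
have : \forall m \near \oo, `|L x - A m x| < emb d.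
  apply: (@cvgr_dist_lt _ _ _ _ _ (fun m => A m x) (L x)).
    exact: op_cauchy_cvg.
  by rewrite -(rmorph0 emb) emb_lt.
(* The index [maxn M N] is close to the limit at [x] and still in the Cauchy range. *)
move=> [M _ MP]; have /= := MP (maxn M N) (leq_maxl _ _).
rewrite -(nrE (_ - A _ x)) emb_lt distrC => /ltW LM.
rewrite -(subrKA (A (maxn M N) x)); apply: le_trans (nrD _ _) _.
by rewrite lerD//; apply: NP => //; exact: leq_maxr.
Qed.

Lemma tclass_complete : (forall n, Tclass md p (A n)) ->
  (forall e : R, 0 < e -> exists N : nat, forall m n : nat,
    (N <= m)%N -> (N <= n)%N -> (tp md p (fun x => (A m x - A n x)%R) < e%:E)%E) ->
  exists B : X -> Y, Tclass md p B /\
    forall e : R, 0 < e -> exists N : nat, forall n : nat,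
      (N <= n)%N -> (tp md p (fun x => (A n x - B x)%R) < e%:E)%E.
Proof.
move=> cA cau; have lAB m n : lin (fun x => A m x - A n x).
  by apply: lin_sub; [exact: (cA m).1|exact: (cA n).1].
have opcau : op_cauchy.
  move=> e /cau[N NP]; exists N => m n Nm Nn.
  exact: (tp_lt (lAB m n) (NP _ _ Nm Nn)).1.
have lL : lin L by apply: lin_op_lim => // n; exact: (cA n).1.
have lAL n : lin (fun x => A n x - L x) by apply: lin_sub lL; exact: (cA n).1.
have cvgL (e : R) : 0 < e -> exists N : nat, forall n : nat,
    (N <= n)%N -> (tp md p (fun x => (A n x - L x)%R) < e%:E)%E.
  (* The norm will cost [d 0 = e' / 2] and the tree constant [e'], in total [e / 2]. *)
  move=> e0; pose e' := e / 3; have e'0 : 0 < e' by rewrite divr_gt0.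
  (* Dividing by [k + 1] compensates the cost of delaying the [k]-th estimate. *)
  pose d k := e' / 2 ^+ k.+1 / k.+1%:R.
  have d0 k : 0 < d k by rewrite !divr_gt0 ?exprn_gt0.
  have /choice[Nf NfP] := fun k => cau (d k) (d0 k).
  exists (Nf 0%N) => n Nn.
  (* The subsequence starts at [n], so that the series represents [A n - L]; partial sums make it
     monotone and at least [Nf k]. *)
  pose m k := (n + \sum_(j < k) Nf j.+1)%N.
  have mS k : (m k <= m k.+1)%N by rewrite /m big_ord_recr /= addnA leq_addr.
  have Nm k : (Nf k <= m k)%N.
    case: k => [|k]; first by rewrite /m big_ord0 addn0.
    by rewrite /m big_ord_recr /= addnA leq_addl.
  have DP k := tp_lt (lAB (m k) (m k.+1)) (NfP k _ _ (Nm k) (leq_trans (Nm k) (mS k))).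
  have LP k j : (Nf k <= j)%N -> op_bound (fun x => A j x - L x) (d k).
    apply: op_bound_lim opcau _ j => i j Ni Nj.
    exact: (tp_lt (lAB i j) (NfP k _ _ Ni Nj)).1.
  apply: (@le_lt_trans _ _ (d 0%N + e')%:E).
    apply: tp_le; [exact: ltW|exact: LP|move=> r r0].
    apply: (@upper_tree_est_le _ _ _ e'); first by rewrite lerDl ltW.
    apply: (@upper_tree_est_series _ _ _ (fun k x => A (m k) x - A (m k.+1) x)
      (fun k x => A (m k) x - L x) d) => // [|k|k|k|k x|k].
    + exact: ltW.
    + exact: (DP k).1.
    + exact: (DP k).2.
    + exact: LP.
    + elim: k => [|k IHk]; first by rewrite big_ord0 add0r /m big_ord0 addn0.
      by rewrite big_ord_recr /= -addrA subrKA.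
    + by rewrite mulrC /d divfK// pnatr_eq0.
  rewrite lte_fin /d /e' expr1 divr1; lra.
(* [L] is the difference of [A N] and [A N - L], both in the class. *)
exists L; split=> //; have [N NP] := cvgL 1 ltr01.
have cAL : Tclass md p (fun x => A N x - L x).
  by apply: tclass_tp_le (ltW (NP _ (leqnn N))).
suff -> : L = fun x => A N x + (-1) *: (A N x - L x).
  by apply: tclass_add => //; exact: tclass_scale.
by apply/funext => x; rewrite scaleN1r opprB addrC subrK.
Qed.

End Completeness.

(** * Assembling the ideal; real and complex scalars *)

Lemma Banach_ideal_modulus : Banach_ideal md p.
Proof.
split; first by move=> W X Y Z A B C; exact: tclass_comp.
split; first exact: tclass_id.
split.
  move=> X Y; split; first exact: tclass0.
  by split=> [A B|c A]; [exact: tclass_add|exact: tclass_scale].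
split.
  move=> X Y; split; first by move=> A _; exact: tp_ge0.
  split; first by move=> A; exact: tclass_eq0.
  by split=> [c A|A B]; [exact: tp_scale|exact: tp_add].
split; first by move=> W X Y Z A B C; exact: tp_comp.
split; first by move=> X Y f y; exact: tp_rank1.
by move=> X Y A; exact: tclass_complete.
Qed.

End TreeEstimates.
End Modulus.

(* For each 1 < p <= oo, (T_p, t_p) is a Banach ideal, both for real
   (K = R) and complex (K = R[i]) Banach spaces. *)
Theorem theorem5p2 (R : realType) (p : \bar R) :
  (1 < p)%E ->
  Banach_ideal (fun x : R => `|x|) p /\
  Banach_ideal (fun z : R[i] => complex.Re `|z|) p.
Proof.
move=> p1; split.
- by apply: (@Banach_ideal_modulus _ _ _ idfun).
- by apply: (@Banach_ideal_modulus _ _ _ (real_complex R)) => //; exact: lecR.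
Qed.
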